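(* Let $f$ be a graph convolutional network, where $f(X,A)\in\mathbb{R}^{n\times c}$ denotes the output of the last graph convolution layer on the graph $(X,A)$. Let $e_v\in\mathbb{R}^n$ be the indicator vector of the target node $v$, let $y\in\{1,\dots,c\}$ be the target class, and let $F(X,A)=\{e_v^\top f(X,A)\}_y\in\mathbb{R}$. Fix an input graph $(X,A)$ and perturbation distributions $\mathcal{D}_X$ on $\mathbb{R}^{n\times d}$ and $\mathcal{D}_A$ on $\mathbb{R}^{n\times n}$. Let $(X_s,A_s)$ be a subgraph explanation of $F$ at $(X,A)$, and let $p$ be the local difference model defined by it, that is, $p(X,A)=F(X_s,A_s)$ and $p(X-\epsilon_X,A-\epsilon_A)=F(X_s-\epsilon_X,A_s-\epsilon_A)$. Then the general unfaithfulness $\Delta(p)$ satisfies $$\Delta(p)\;\ge\;\Big[\,C+\mathbb{E}_{\epsilon_X,\epsilon_A}F(X-\epsilon_X,A-\epsilon_A)-\mathbb{E}_{\epsilon_X,\epsilon_A}F(X_s-\epsilon_X,A_s-\epsilon_A)\Big]^2,$$ where $C=F(X_s,A_s)-F(X,A)$ and $\epsilon_X\sim\mathcal{D}_X$, $\epsilon_A\sim\mathcal{D}_A$.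
   Context: A graph is a pair $(X,A)$ with node feature matrix $X\in\mathbb{R}^{n\times d}$ ($n$ nodes, $d$ features) and weighted adjacency matrix $A\in\mathbb{R}^{n\times n}$ with nonnegative entries. A graph convolutional network $f$ is a stack of graph convolution layers and dense layers separated by ReLU activations, where a graph convolution layer maps $X\mapsto N(A)XW$ with $W$ a weight matrix, $N(A)=D^{-1/2}(A+I)D^{-1/2}$, and $D$ the degree matrix. It is assumed that $F$ is defined at all points where it is evaluated and that all expectations below exist and are finite. Subgraph explanation: given $F$ and an input $(X,A)$, a subgraph explanation is a pair $(X_s,A_s)$ (of the same dimensions as $(X,A)$) that minimizes $L(X_s,A_s,F)$ subject to $s(X_s,A_s)\le K$, where the real-valued performance penalty $L$ and the real-valued size function $s$ are user-defined and $K$ is a constant. General unfaithfulness: for a function $p$ (a ''local difference model'' for $F$), an input $(X,A)$, and distributions $\mathcal{D}_X,\mathcal{D}_A$, $$\Delta(p)=\mathbb{E}_{\epsilon_X\sim\mathcal{D}_X,\ \epsilon_A\sim\mathcal{D}_A}\Big[p(X,A)-p(X-\epsilon_X,A-\epsilon_A)-\big(F(X,A)-F(X-\epsilon_X,A-\epsilon_A)\big)\Big]^2 ,$$ that is, the expectation of the square of the bracket. *)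

(* Defs.v *)
From HB Require Import structures.
From mathcomp Require Import all_boot all_order all_algebra.
From mathcomp Require Import all_classical all_reals all_analysis.

Set Implicit Arguments.
Unset Strict Implicit.
Unset Printing Implicit Defensive.

Import Order.TTheory GRing.Theory Num.Theory.
Import numFieldNormedType.Exports.

Local Open Scope classical_set_scope.
Local Open Scope ring_scope.

(* Matrices with their Borel sigma-algebra.  The type is convertible to
   'M[R]_(m, n), so its elements can be used as matrices. *)
Definition borelM (R : realType) (m n : nat) :=
  g_sigma_algebraType (@open 'M[R]_(m, n)).

Section Gcn.
Context {R : realType}.

Definition relu (m n : nat) (Z : 'M[R]_(m, n)) : 'M[R]_(m, n) :=
  map_mx (Num.max 0) Z.

(* "The degree matrix" D in D^{-1/2} (A + I) D^{-1/2} is used in the literature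
   both for the degrees of A + I (loops = true) and for the degrees of A
   (loops = false).  The convention is a parameter. *)
Definition degree (loops : bool) (n : nat) (A : 'M[R]_n) (i : 'I_n) : R :=
  \sum_j (A + (loops%:R)%:M) i j.

(* D^{-1/2} exists as a real matrix exactly when all degrees are positive.
   Outside this domain Num.sqrt and _^-1 take default values. *)
Definition normalizable (loops : bool) (n : nat) (A : 'M[R]_n) : Prop :=
  forall i, 0 < degree loops A i.

Definition normalized (loops : bool) (n : nat) (A : 'M[R]_n) : 'M[R]_n :=
  let Dhalf := diag_mx (\row_i (Num.sqrt (degree loops A i))^-1) in
  Dhalf *m (A + 1%:M) *m Dhalf.

Definition conv_layer (loops : bool) (n m k : nat) (W : 'M[R]_(m, k))
    (A : 'M[R]_n) (Z : 'M[R]_(n, m)) : 'M[R]_(n, k) :=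
  normalized loops A *m Z *m W.

(* The same affine map is applied to the features of every node. *)
Definition dense_layer (n m k : nat) (W : 'M[R]_(m, k)) (b : 'rV[R]_k)
    (Z : 'M[R]_(n, m)) : 'M[R]_(n, k) :=
  Z *m W + \matrix_(i, j) b ord0 j.

End Gcn.

(* The dense layers that follow the last graph convolution layer, each one
   preceded by a ReLU. *)
Inductive dense_stack (R : realType) : nat -> nat -> Type :=
| DenseNil m : dense_stack R m m
| DenseCons m k o (W : 'M[R]_(m, k)) (b : 'rV[R]_k) (rest : dense_stack R k o) :
    dense_stack R m o.

(* gcn R d c o: networks with d input features, o output features, and a last
   graph convolution layer of width c.  A ReLU separates consecutive layers. *)
Inductive gcn (R : realType) : nat -> nat -> nat -> Type :=
| LastConv m c o (W : 'M[R]_(m, c)) (rest : dense_stack R c o) : gcn R m c o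
| Conv m k c o (W : 'M[R]_(m, k)) (rest : gcn R k c o) : gcn R m c o
| Dense m k c o (W : 'M[R]_(m, k)) (b : 'rV[R]_k) (rest : gcn R k c o) :
    gcn R m c o.

Section Eval.
Context {R : realType}.
Variables (loops : bool) (n : nat).

Fixpoint dense_stack_output (m o : nat) (s : dense_stack R m o) :
    'M[R]_(n, m) -> 'M[R]_(n, o) :=
  match s with
  | DenseNil _ => fun Z => Z
  | DenseCons _ _ _ W b rest => fun Z =>
      dense_stack_output rest (dense_layer W b (relu Z))
  end.

Fixpoint last_conv_output (d c o : nat) (f : gcn R d c o) :
    'M[R]_(n, d) -> 'M[R]_n -> 'M[R]_(n, c) :=
  match f with
  | LastConv _ _ _ W _ => fun X A => conv_layer loops W A X
  | Conv _ _ _ _ W rest => fun X A =>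
      last_conv_output rest (relu (conv_layer loops W A X)) A
  | Dense _ _ _ _ W b rest => fun X A =>
      last_conv_output rest (relu (dense_layer W b X)) A
  end.

Fixpoint gcn_tail (d c o : nat) (f : gcn R d c o) : dense_stack R c o :=
  match f with
  | LastConv _ _ _ _ s => s
  | Conv _ _ _ _ _ rest => gcn_tail rest
  | Dense _ _ _ _ _ _ rest => gcn_tail rest
  end.

Definition gcn_output (d c o : nat) (f : gcn R d c o)
    (X : 'M[R]_(n, d)) (A : 'M[R]_n) : 'M[R]_(n, o) :=
  dense_stack_output (gcn_tail f) (last_conv_output f X A).

Definition target_score (d c o : nat) (f : gcn R d c o) (v : 'I_n) (y : 'I_c)
    (X : 'M[R]_(n, d)) (A : 'M[R]_n) : R :=
  let e_v : 'cV[R]_n := delta_mx v ord0 in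
  (e_v^T *m last_conv_output f X A) ord0 y.

End Eval.

Section Explanation.
Context {R : realType} {n d : nat}.
Local Notation graph_fun := ('M[R]_(n, d) -> 'M[R]_n -> R).

(* The competitors range over all pairs of matrices of the right dimensions;
   any further restriction on them can be put into the size function s. *)
Definition subgraph_explanation
    (L : 'M[R]_(n, d) -> 'M[R]_n -> graph_fun -> R) (s : graph_fun) (K : R)
    (F : graph_fun) (Xs : 'M[R]_(n, d)) (As : 'M[R]_n) : Prop :=
  s Xs As <= K /\
  forall (Y : 'M[R]_(n, d)) (B : 'M[R]_n), s Y B <= K -> L Xs As F <= L Y B F.

Definition subgraph_difference_model (F : graph_fun)
    (X : 'M[R]_(n, d)) (A : 'M[R]_n) (Xs : 'M[R]_(n, d)) (As : 'M[R]_n)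
    (p : graph_fun) : Prop :=
  p X A = F Xs As /\
  forall (eX : 'M[R]_(n, d)) (eA : 'M[R]_n),
    p (X - eX) (A - eA) = F (Xs - eX) (As - eA).

Definition squared_gap (F p : graph_fun) (X : 'M[R]_(n, d)) (A : 'M[R]_n)
    (e : borelM R n d * borelM R n n) : R :=
  (p X A - p (X - e.1) (A - e.2) - (F X A - F (X - e.1) (A - e.2))) ^+ 2.

(* The two perturbations are independent: their joint law is DX \x DA. *)
Definition unfaithfulness (F : graph_fun) (X : 'M[R]_(n, d)) (A : 'M[R]_n)
    (DX : probability (borelM R n d) R) (DA : probability (borelM R n n) R)
    (p : graph_fun) : \bar R :=
  ('E_((DX \x DA)%E)[squared_gap F p X A])%E.

End Explanation.

(* Main.v *)
(* The bracket in the unfaithfulness equals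
   Z = C + F(X - eX, A - eA) - F(Xs - eX, As - eA), so the bound is Jensen's
   inequality E[Z]^2 <= E[Z^2], i.e. nonnegativity of the variance of Z. *)
Require Import Defs.
From HB Require Import structures.
From mathcomp Require Import all_boot all_order all_algebra.
From mathcomp Require Import all_classical all_reals all_analysis.
From mathcomp Require Import ring.

Set Implicit Arguments.
Unset Strict Implicit.
Unset Printing Implicit Defensive.

Import Order.TTheory GRing.Theory Num.Theory.
Import numFieldNormedType.Exports.

Local Open Scope classical_set_scope.
Local Open Scope ring_scope.

(** Substituting the values of [p] makes the bracket a constant plus a difference of two integrable
    scores, so linearity identifies its mean with the base of the squared lower bound.
    [sqr_expectation_le] then gives the inequality: with [m] the mean of [Z], expanding 0 <=
    E[(Z - m)^2] leaves E[Z^2] - m^2. *)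

Lemma sqr_expectation_le {disp : measure_display} {T : measurableType disp}
    {R : realType} (P : probability T R) (Z : T -> R) :
  Z \in Lfun P 1 -> (fun x => Z x ^+ 2) \in Lfun P 1 ->
  ('E_P[Z] ^+ 2 <= 'E_P[fun x => (Z x ^+ 2)%R])%E.
Proof.
move=> Z1 Z2.
have := expectation_fin_num Z1.
(* Integrability makes the mean finite, so it can serve as a real centering constant. *)
set m := fine 'E_P[Z]%E => Zfin.
have EZ : 'E_P[Z]%E = m%:E by rewrite fineK.
have : (0%:E <= 'E_P[fun x => ((Z x - m) ^+ 2)%R])%E.
  by apply: expectation_ge0 => x; exact: sqr_ge0.
(* The expansion is written with operations on functions, the form in which linearity of expectation
   applies. *)
have -> : (fun x => (Z x - m) ^+ 2) =
    ((fun x => Z x ^+ 2) \- ((2 * m) \o* Z)) \+ cst (m ^+ 2).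
  by apply/funext => x /=; ring.
have mZ : (2 * m) \o* Z \in Lfun P 1 by exact: Lfun_scale.
rewrite expectationD ?rpredB ?Lfun_cst // expectationB // expectationZl //.
rewrite expectation_cst EZ -EFin_expe.
have /fineK <- := expectation_fin_num Z2.
rewrite -EFinM -EFinB -EFinD !lee_fin => ge0.
(* The cross term contributes -2m^2 and the constant m^2, for a total of -m^2. *)
by rewrite -subr_ge0 (le_trans ge0) //; rewrite le_eqVlt; apply/orP; left; apply/eqP; ring.
Qed.

Theorem proposition3p3 (R : realType) (loops : bool) (n d c o : nat)
    (f : gcn R d c o) (v : 'I_n) (y : 'I_c)
    (X : 'M[R]_(n, d)) (A : 'M[R]_n)
    (DX : probability (borelM R n d) R) (DA : probability (borelM R n n) R)
    (L : 'M[R]_(n, d) -> 'M[R]_n -> ('M[R]_(n, d) -> 'M[R]_n -> R) -> R)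
    (s : 'M[R]_(n, d) -> 'M[R]_n -> R) (K : R)
    (Xs : 'M[R]_(n, d)) (As : 'M[R]_n) (p : 'M[R]_(n, d) -> 'M[R]_n -> R) :
  let F := target_score loops f v y in
  (forall i j, 0 <= A i j) ->
  subgraph_explanation L s K F Xs As ->
  subgraph_difference_model F X A Xs As p ->
  normalizable loops A ->
  normalizable loops As ->
  {ae DA, forall e : borelM R n n, normalizable loops (A - e)} ->
  {ae DA, forall e : borelM R n n, normalizable loops (As - e)} ->
  (DX \x DA)%E.-integrable setT
    (fun e : borelM R n d * borelM R n n => (F (X - e.1) (A - e.2))%:E) ->
  (DX \x DA)%E.-integrable setT
    (fun e : borelM R n d * borelM R n n => (F (Xs - e.1) (As - e.2))%:E) ->
  (DX \x DA)%E.-integrable setT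
    (fun e : borelM R n d * borelM R n n => (squared_gap F p X A e)%:E) ->
  let C := F Xs As - F X A in
  ((C%:E + 'E_((DX \x DA)%E)[(fun e => F (X - e.1) (A - e.2))%R]
         - 'E_((DX \x DA)%E)[(fun e => F (Xs - e.1) (As - e.2))%R]) ^+ 2
   <= unfaithfulness F X A DX DA p)%E.
Proof.
move=> F _ _ [pXA pe] _ _ _ _ iF iFs iG; cbv zeta.
set C := F Xs As - F X A.
(* The ascription equips the product measure with its probability structure. *)
pose P : probability _ R := (DX \x DA)%E.
pose f1 := fun e : borelM R n d * borelM R n n => F (X - e.1) (A - e.2).
pose f2 := fun e : borelM R n d * borelM R n n => F (Xs - e.1) (As - e.2).
pose Z := (cst C \+ f1) \- f2.
have gapE : squared_gap F p X A = fun e => Z e ^+ 2.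
  apply/funext => e.
  by rewrite /squared_gap /Z /f1 /f2 /C /= pXA pe; congr (_ ^+ 2); ring.
have f11 : f1 \in Lfun P 1 by apply/Lfun1_integrable.
have f21 : f2 \in Lfun P 1 by apply/Lfun1_integrable.
have Cf11 : cst C \+ f1 \in Lfun P 1 by rewrite rpredD // Lfun_cst.
have Z1 : Z \in Lfun P 1 by rewrite rpredB.
(* [Z ^+ 2] is the squared gap itself, so [iG] gives its integrability. *)
have Z2 : (fun e => Z e ^+ 2) \in Lfun P 1.
  by apply/Lfun1_integrable; rewrite -gapE.
have := sqr_expectation_le Z1 Z2.
rewrite /unfaithfulness gapE /Z expectationB // expectationD ?Lfun_cst //.
by rewrite expectation_cst.
Qed.
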